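(* For every $\varepsilon>0$ there exists $t_0$ such that for every integer $t\geq t_0$ there is a graph $G$ that admits a quasi-$K_t$-minor but does not admit a $K_{(\frac23+\varepsilon)t}$-minor.
   Context: All graphs are finite and simple. A graph $G$ has a $K_p$-minor if there are $p$ non-empty, pairwise disjoint vertex sets (bags) $B_1,\dots,B_p\subseteq V(G)$, each inducing a connected subgraph of $G$, such that for all $i\neq j$ there is an edge between some vertex of $B_i$ and some vertex of $B_j$. A graph $G$ has a quasi-$K_p$-minor if there are $p$ non-empty, pairwise disjoint vertex sets $B_1,\dots,B_p\subseteq V(G)$ such that for all $i\neq j$ the set $B_i\cup B_j$ induces a connected subgraph of $G$ (the individual sets $B_i$ need not induce connected subgraphs). *)

(* Defs.v *)
From HB Require Import structures.
From mathcomp Require Import all_boot all_order all_algebra reals.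

Set Implicit Arguments.
Unset Strict Implicit.
Unset Printing Implicit Defensive.

Record sgraph := SGraph {
  vertex :> finType;
  adj : rel vertex;
  adj_sym : symmetric adj;
  adj_irr : irreflexive adj
}.

Section Induced.
Variables (G : sgraph) (A : {set G}).

Definition induced_adj : rel {x : G | x \in A} :=
  fun u v => adj (val u) (val v).

Lemma induced_adj_sym : symmetric induced_adj.
Proof. by move=> u v; apply: adj_sym. Qed.

Lemma induced_adj_irr : irreflexive induced_adj.
Proof. by move=> u; apply: adj_irr. Qed.

Definition induced : sgraph := SGraph induced_adj_sym induced_adj_irr.
End Induced.

(* The graph without vertices is connected here; the sets tested below are
   always non-empty. *)
Definition connected_graph (G : sgraph) : Prop :=
  forall x y : G, connect (@adj G) x y.

Definition bags (G : sgraph) (p : nat) (B : 'I_p -> {set G}) : Prop :=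
  (forall i, B i != set0) /\ (forall i j, i != j -> [disjoint B i & B j]).

Definition has_clique_minor (G : sgraph) (p : nat) : Prop :=
  exists B : 'I_p -> {set G},
    [/\ bags B,
        forall i, connected_graph (induced (B i))
      & forall i j, i != j ->
          exists x y : G, [/\ x \in B i, y \in B j & adj x y]].

Definition has_quasi_clique_minor (G : sgraph) (p : nat) : Prop :=
  exists B : 'I_p -> {set G},
    bags B /\
    forall i j, i != j -> connected_graph (induced (B i :|: B j)).

(* Main.v *)
Require Import Defs.
From mathcomp Require Import all_boot all_order all_algebra reals.
From mathcomp Require Import zify.

Set Implicit Arguments.
Unset Strict Implicit.
Unset Printing Implicit Defensive.

(** Take two vertices above each index [i < t] and, for every two indices, all
    four edges between the corresponding pairs except one chosen at random:
    any two pairs then induce a connected graph, so they form a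
    quasi-[K_t]-minor. Bags with at least three vertices number at most
    [2t/3], so a [K_p]-minor with [p >= (2/3 + eps) t] has at least [3/2 eps
    t] bags with at most two vertices. A third of these live above disjoint
    sets of indices, hence depend on independent random choices, and two
    given such bags are non-adjacent with probability bounded below. The
    probability that all these bags are pairwise adjacent is thus [exp (- c
    t^2)], which beats the [exp (O (t log t))] possible families of bags. *)

(** * Counting the labellings that avoid prescribed patterns *)

Lemma leq_card_bigcup (I T : finType) (P : pred I) (F : I -> {set T}) :
  #|\bigcup_(i | P i) F i| <= \sum_(i | P i) #|F i|.
Proof.
elim/big_ind2: _ => [|m X n Y ? ?|//]; first by rewrite cards0.
by apply: leq_trans (leq_card_setU _ _) (leq_add _ _).
Qed.

Definition differs_on (T A : finType) (g : {ffun T -> A}) (D : {set T}) :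
  pred {ffun T -> A} := fun w => [exists x in D, w x != g x].

(** Membership in [X] does not read the coordinates in [D], so overwriting [w] by [g] on [D] stays
    in [X]; the result and the lost values on [D] together determine [w]. *)
Lemma card_agreeing_on (T A : finType) (g : {ffun T -> A}) (D : {set T})
    (X : {set {ffun T -> A}}) :
  (forall w w' : {ffun T -> A}, {in ~: D, w =1 w'} -> w \in X -> w' \in X) ->
  #|X| <= #|X :\: [set w | differs_on g D w]| * #|A| ^ #|D|.
Proof.
move=> Xext.
pose overwrite (w : {ffun T -> A}) := [ffun x => if x \in D then g x else w x].
pose restr (w : {ffun T -> A}) : {ffun {x | x \in D} -> A} :=
  [ffun u => w (val u)].
have inj : {in X &, injective (fun w => (overwrite w, restr w))}.
  move=> w w' _ _ [/ffunP eo /ffunP er]; apply/ffunP => x.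
  case: (boolP (x \in D)) => xD.
    by have := er (Sub x xD); rewrite !ffunE.
  by have := eo x; rewrite !ffunE (negbTE xD).
rewrite -(card_in_imset inj) -[#|D|]card_sig -card_ffun -[#|{ffun _}|]cardsT.
rewrite -cardsX; apply/subset_leq_card/subsetP => _ /imsetP[w wX ->].
rewrite !inE /= andbT; apply/andP; split.
  by apply/existsP => -[x /andP[xD]]; rewrite ffunE xD eqxx.
by apply: Xext wX => x; rewrite inE ffunE => /negbTE ->.
Qed.

(** Independence in counting form: the conditions for the other keys do not read [D k], so at least
    one in [#|A| ^ b] of the functions satisfying them agrees with [g] on [D k]. Each key thus costs
    a factor [1 - 1 / #|A| ^ b]. *)
Lemma card_differs_on_all (T A : finType) (K : eqType) (g : {ffun T -> A})
    (D : K -> {set T}) (b : nat) (s : seq K) :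
  0 < #|A| -> uniq s -> {in s &, forall k l, k != l -> [disjoint D k & D l]} ->
  (forall k, #|D k| <= b) ->
  #|[set w | all (fun k => differs_on g (D k) w) s]| * (#|A| ^ b) ^ size s
    <= (#|A| ^ b).-1 ^ size s * #|{ffun T -> A}|.
Proof.
move=> A_gt0 + + Db; elim: s => [|k s IHs] /=.
  by rewrite muln1 mul1n max_card.
case/andP=> ks us dis.
have {}IHs := IHs us (sub_in2 (fun x => @mem_behead _ (k :: s) x) dis).
set X' := [set w | all _ s] in IHs; set X := [set w | _].
have defX : X = X' :&: [set w | differs_on g (D k) w].
  by apply/setP => w; rewrite !inE andbC.
have leX' : #|X'| <= #|X' :\: [set w | differs_on g (D k) w]| * #|A| ^ b.
  suff /(card_agreeing_on g) le : forall w w' : {ffun T -> A},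
      {in ~: D k, w =1 w'} -> w \in X' -> w' \in X'.
    by apply: leq_trans le _; rewrite leq_mul2l leq_pexp2l ?Db ?orbT.
  move=> w w' eww'; rewrite !inE => /allP ws; apply/allP => l ls.
  have /existsP[x /andP[xl wx]] := ws l ls.
  apply/existsP; exists x; rewrite xl -eww' // inE.
  have kl : k != l by apply: contraNneq ks => ->.
  apply: contraTN xl => xk; rewrite (disjointFr _ xk) //.
  by apply: dis kl; rewrite !inE ?eqxx ?ls ?orbT.
have := cardsID [set w | differs_on g (D k) w] X'; rewrite -defX => cX'.
rewrite !expnS; set M := #|A| ^ b in IHs leX' *.
have M_gt0 : 0 < M by rewrite expn_gt0 A_gt0.
have leX : #|X| * M <= M.-1 * #|X'| by rewrite -[M in X in _ <= X]prednK //; nia.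
rewrite mulnA; apply: leq_trans (leq_mul leX (leqnn _)) _.
by rewrite -!mulnA leq_mul2l IHs orbT.
Qed.

(* [lam] selects one vertex [(i, lam i)] above each index [i], and [pi] groups
   some of the indices into [s] bags; a good labelling leaves two of the bags
   of selected vertices with no edge between them. *)
Definition good_labelling (t s : nat)
    (w : {ffun 'I_t * 'I_t -> bool * bool}) : Prop :=
  forall (lam : {ffun 'I_t -> bool}) (pi : {ffun 'I_t -> option 'I_s}),
    (forall k, #|[set i | pi i == Some k]| <= 2) ->
    exists k l, k != l /\ forall i j, pi i = Some k -> pi j = Some l ->
      w (i, j) = (lam i, lam j) /\ w (j, i) = (lam j, lam i).

(* Two bags involve at most [8] ordered pairs of indices, each with [4] possible
   labels; there are at most [(2 * s.+1) ^ t] choices of [lam] and [pi]. *)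
Lemma exists_good_labelling (t s : nat) :
  (2 * s.+1) ^ t * (4 ^ 8).-1 ^ 'C(s, 2) < (4 ^ 8) ^ 'C(s, 2) ->
  exists w : {ffun 'I_t * 'I_t -> bool * bool}, good_labelling s w.
Proof.
set M := 4 ^ 8 => count.
pose F (pi : {ffun 'I_t -> option 'I_s}) k := [set i | pi i == Some k].
pose D pi (kl : 'I_s * 'I_s) :=
  setX (F pi kl.1) (F pi kl.2) :|: setX (F pi kl.2) (F pi kl.1).
(* [D] is symmetric in the two bags, so each unordered pair may occur only once for the sets to be
   disjoint. *)
pose P := [set kl : 'I_s * 'I_s | kl.2 < kl.1].
have cP : #|P| = 'C(s, 2).
  rewrite -bin2_sum big_mkord -sum1_card.
  transitivity (\sum_(k < s) \sum_(l < s | l < k) 1).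
    by rewrite pair_big_dep; apply: eq_bigl => kl; rewrite inE.
  apply: eq_bigr => k _.
  by rewrite (big_ord_narrow (ltnW (ltn_ord k))) sum1_card card_ord.
pose g (lam : {ffun 'I_t -> bool}) : {ffun 'I_t * 'I_t -> bool * bool} :=
  [ffun ij => (lam ij.1, lam ij.2)].
pose Q := [set pi | [forall k, #|F pi k| <= 2]].
pose bad (c : {ffun 'I_t -> bool} * {ffun 'I_t -> option 'I_s}) :=
  [set w | all (fun kl => differs_on (g c.1) (D c.2 kl) w) (enum P)].
have leD pi kl : pi \in Q -> #|D pi kl| <= 8.
  rewrite inE => /forallP Fpi; apply: leq_trans (leq_card_setU _ _) _.
  rewrite !cardsX.
  by have := leq_mul (Fpi kl.1) (Fpi kl.2); rewrite [X in _ + X]mulnC; lia.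
have disD pi : {in enum P &, forall k l, k != l -> [disjoint D pi k & D pi l]}.
  move=> [k k'] [l l']; rewrite !mem_enum !inE /= => lek lel.
  apply: contraNT => /pred0Pn[[i j]] /=; rewrite !inE /=.
  by case/andP=> /orP[]/andP[/eqP-> /eqP->] /orP[]/andP[/eqP[ek] /eqP[el]];
     apply/eqP; congr pair; apply/val_inj; move: lek lel; rewrite ?ek ?el //=; lia.
have lebad c : c.2 \in Q ->
    #|bad c| * M ^ 'C(s, 2) <= M.-1 ^ 'C(s, 2) * #|{ffun 'I_t * 'I_t -> bool * bool}|.
  move=> cQ.
  have A4 : #|{: bool * bool}| = 4 by rewrite card_prod card_bool.
  have := @card_differs_on_all _ _ _ (g c.1) (D c.2) 8 (enum P) _ (enum_uniq _)
    (disD c.2) (fun kl => leD c.2 kl cQ).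
  by rewrite A4 -/M -cardE cP; apply.
(* Union bound over [lam] and [pi]: some labelling is bad for no choice. *)
have : #|\bigcup_(c in setX setT Q) bad c| < #|{ffun 'I_t * 'I_t -> bool * bool}|.
  have [Om_gt0 M_gt0] : 0 < #|{ffun 'I_t * 'I_t -> bool * bool}| /\ 0 < M.
    by rewrite card_ffun !expn_gt0 card_prod card_bool.
  rewrite -(ltn_pmul2r (m := M ^ 'C(s, 2))) ?expn_gt0 ?M_gt0 //.
  apply: leq_ltn_trans (leq_mul (leq_card_bigcup _ _) (leqnn _)) _.
  rewrite big_distrl /=.
  have le2 : forall c, c \in setX setT Q -> #|bad c| * M ^ 'C(s, 2) <=
      M.-1 ^ 'C(s, 2) * #|{ffun 'I_t * 'I_t -> bool * bool}|.
    by move=> [lam pi]; rewrite in_setX => /andP[_ piQ]; exact: lebad.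
  apply: leq_ltn_trans (leq_sum _ le2) _; rewrite sum_nat_const mulnA.
  rewrite [X in _ < X]mulnC ltn_pmul2r //; apply: leq_ltn_trans count.
  rewrite leq_mul2r; apply/orP; right.
  apply: leq_trans (max_card _) _.
  by rewrite card_prod !card_ffun card_bool card_option !card_ord expnMn.
rewrite ltnNge => /negP nle.
have [w /bigcupP wP] : exists w, w \notin \bigcup_(c in setX setT Q) bad c.
  apply/existsP; rewrite -negb_forall; apply/negP => /forallP all_w; apply: nle.
  by apply/subset_leq_card/subsetP => w _; exact: all_w.
exists w => lam pi Fpi.
have : w \notin bad (lam, pi).
  apply/negP => wb; apply: wP; exists (lam, pi) => //.
  by rewrite !inE /=; apply/forallP.
rewrite inE => /allPn[[k l]]; rewrite mem_enum inE /= => lk.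
move=> /existsPn eqw; exists k, l; split; first by rewrite -val_eqE /=; lia.
move=> i j /eqP ik /eqP jl.
have := eqw (i, j); have := eqw (j, i).
by rewrite !inE /= ik jl orbT /= !negbK !ffunE /= => /eqP -> /eqP ->.
Qed.

(** * The numerical estimate behind the union bound *)

Lemma bernoulli_expn (M n : nat) : (M + n) * M ^ n <= M * M.+1 ^ n.
Proof.
elim: n => [|n IHn]; first by rewrite addn0.
have le : M ^ n <= M.+1 ^ n by case: n {IHn} => // n; rewrite leq_exp2r.
rewrite !expnS; nia.
Qed.

(** The binomial is at least [2 * n * t] for an [n] linear in [t], so it suffices to compare [t]-th
    roots. There Bernoulli, squared, yields a factor quadratic in [n], which beats the linear
    [2 * s.+1]. *)
Lemma count_lt_expn (M d t : nat) : 0 < M -> 0 < d ->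
  4096 * M ^ 2 * d ^ 4 <= t ->
  (2 * (t %/ d).+1) ^ t * M ^ 'C(t %/ d, 2) < M.+1 ^ 'C(t %/ d, 2).
Proof.
move=> M_gt0 d_gt0 let0; set s := t %/ d.
(* The 16 comes from ['C(s, 2) >= s.+1 ^ 2 / 8 >= t ^ 2 / (8 * d ^ 2)], which has to be at least
   [2 * n * t]; the first bound needs [s >= 3]. *)
pose q := 16 * d ^ 2; pose n := t %/ q.
have d2_gt0 : 0 < d ^ 2 by rewrite expn_gt0 d_gt0.
have d4E : d ^ 4 = d ^ 2 * d ^ 2 by rewrite -expnD.
have d_le : d <= d ^ 2 by rewrite expnS expn1 leq_pmulr.
have M2_gt0 : 0 < M ^ 2 by rewrite expn_gt0 M_gt0.
have q_gt0 : 0 < q by rewrite muln_gt0.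
have lt_t_s : t < s.+1 * d by rewrite ltn_ceil.
have le_s_t : s <= t by exact: leq_div.
have lt_t_n : t < n.+1 * q by rewrite ltn_ceil.
have le_nq : n * q <= t by exact: leq_trunc_div.
have le_t0 : 4096 * d ^ 2 * d ^ 2 <= t.
  by apply: leq_trans let0; rewrite d4E; nia.
have t_gt0 : 0 < t by nia.
have s_ge3 : 2 < s by rewrite /s leq_divRL //; nia.
have n_gt0 : 0 < n by rewrite /n divn_gt0 // /q; nia.
(* As [n >= t / (2 * q)], this is where the threshold [4096 * M ^ 2 * d ^ 4] comes from. *)
have n2_ge : 4 * M ^ 2 * t <= n ^ 2.
  have : t ^ 2 <= (2 * n * q) ^ 2 by rewrite leq_exp2r //; nia.
  have -> : (2 * n * q) ^ 2 = 1024 * d ^ 4 * n ^ 2.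
    by rewrite d4E -[n ^ 2]mulnn -[(_ * q) ^ 2]mulnn /q; lia.
  have : 0 < d ^ 4 by rewrite expn_gt0 d_gt0.
  move: let0; set D4 := d ^ 4; set m2 := M ^ 2; set n2 := n ^ 2 => let0 D4p le2.
  have D4p' : 0 < 1024 * D4 by lia.
  rewrite -(leq_pmul2l D4p').
  apply: leq_trans le2; rewrite -mulnn.
  by have := leq_mul let0 (leqnn t); lia.
have C_ge : 2 * n * t <= 'C(s, 2).
  have : 8 * 'C(s, 2) >= s.+1 ^ 2.
    have := mul_bin_diag s 1; rewrite bin1.
    rewrite -mulnn; nia.
  have : t ^ 2 <= (s.+1 * d) ^ 2 by rewrite leq_exp2r // ltnW.
  rewrite expnMn => le1 le2.
  have : t * (n * q) <= t ^ 2 by rewrite -mulnn leq_mul2l le_nq orbT.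
  rewrite /q; nia.
have key : 2 * s.+1 * (M ^ n) ^ 2 < (M.+1 ^ n) ^ 2.
  have : ((M + n) * M ^ n) ^ 2 <= (M * M.+1 ^ n) ^ 2.
    by rewrite leq_exp2r ?bernoulli_expn.
  rewrite !expnMn => le1.
  rewrite -(ltn_pmul2l M2_gt0); apply: leq_trans le1.
  have F_gt0 : 0 < (M ^ n) ^ 2 by rewrite !expn_gt0 M_gt0.
  have lt : M ^ 2 * (2 * s.+1) < (M + n) ^ 2 by rewrite sqrnD; nia.
  by rewrite mulnA ltn_pmul2r.
rewrite -(subnK C_ge) !expnD.
set A := M ^ (_ - _); set B := M.+1 ^ (_ - _).
have A_gt0 : 0 < A by rewrite expn_gt0 M_gt0.
have leAB : A <= B.
  by rewrite /A /B; case: (_ - _) => // m; rewrite leq_exp2r.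
have : (2 * s.+1 * (M ^ n) ^ 2) ^ t < ((M.+1 ^ n) ^ 2) ^ t.
  by rewrite ltn_exp2r.
have expE x : ((x ^ n) ^ 2) ^ t = x ^ (2 * n * t).
  by rewrite -!expnM; congr expn; lia.
rewrite [X in X < _]expnMn !expE; nia.
Qed.

(** * The graph of a labelling and its quasi-clique-minor *)

Section PairGraph.
Variables (t : nat) (w : {ffun 'I_t * 'I_t -> bool * bool}).

(* [w (i, j)] is read only for [i < j]; the value on [i = j] is irrelevant. *)
Definition missing (u v : 'I_t * bool) : bool :=
  if u.1 < v.1 then w (u.1, v.1) == (u.2, v.2)
  else w (v.1, u.1) == (v.2, u.2).

Definition pair_adj : rel ('I_t * bool) :=
  fun u v => (u.1 != v.1) && ~~ missing u v.

Lemma pair_adj_sym : symmetric pair_adj.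
Proof.
move=> u v; rewrite /pair_adj /missing eq_sym.
by case: ltngtP => // /val_inj ->; rewrite eqxx.
Qed.

Lemma pair_adj_irr : irreflexive pair_adj.
Proof. by move=> u; rewrite /pair_adj eqxx. Qed.

Definition pair_graph : sgraph := SGraph pair_adj_sym pair_adj_irr.

Lemma missing_unique i j x y x' y' : missing (i, x) (j, y) ->
  missing (i, x') (j, y') -> x' = x /\ y' = y.
Proof.
by rewrite /missing /=; case: ifP => _ /eqP-> /eqP[-> ->].
Qed.

Definition fibre (i : 'I_t) : {set pair_graph} := [set u | u.1 == i].

(** The four possible edges between two fibres form a 4-cycle; removing one leaves a path through
    all four vertices. *)
Lemma connected_fibres i j : i != j ->
  connected_graph (induced (fibre i :|: fibre j)).
Proof.
move=> ij.
have csym : connect_sym (@adj (induced (fibre i :|: fibre j))).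
  exact/sym_connect_sym/adj_sym.
have cross (u v : induced (fibre i :|: fibre j)) :
    (val u).1 = i -> (val v).1 = j -> connect (@adj _) u v.
  have Wi x : ((i, x) : pair_graph) \in fibre i :|: fibre j.
    by rewrite !inE eqxx.
  have Wj y : ((j, y) : pair_graph) \in fibre i :|: fibre j.
    by rewrite !inE eqxx orbT.
  case: u v => [[i' x] uW] [[j' y] vW] /= ei ej; subst i' j'.
  case: (boolP (missing (i, x) (j, y))) => [mis|nmis]; last first.
    by apply: connect1; rewrite /= /induced_adj /= /pair_adj ij.
  have e x' y' (uW' : _) (vW' : _) : (x' != x) || (y' != y) ->
      @adj (induced (fibre i :|: fibre j)) (exist _ (i, x') uW') (exist _ (j, y') vW').
    move=> ne; rewrite /= /induced_adj /= /pair_adj ij /=.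
    by apply: contraTN ne => /(missing_unique mis)[-> ->]; rewrite !eqxx.
  apply: (@connect_trans _ _ (exist _ (j, ~~ y) (Wj _))).
    by apply/connect1/e; rewrite orbC; case: (y).
  apply: (@connect_trans _ _ (exist _ (i, ~~ x) (Wi _))).
    by rewrite csym; apply/connect1/e; case: (x).
  by apply/connect1/e; case: (x).
move=> u v; have := valP u; have := valP v.
rewrite !inE => /orP[]/eqP ev /orP[]/eqP eu.
- have W : ((j, true) : pair_graph) \in fibre i :|: fibre j by rewrite !inE eqxx orbT.
  apply: (@connect_trans _ _ (exist _ (j, true) W)); first exact: cross.
  by rewrite csym; apply: cross.
- by rewrite csym; apply: cross.
- exact: cross.
- have W : ((i, true) : pair_graph) \in fibre i :|: fibre j by rewrite !inE eqxx.
  apply: (@connect_trans _ _ (exist _ (i, true) W)); last exact: cross.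
  by rewrite csym; apply: cross.
Qed.

Lemma pair_graph_quasi_clique_minor : has_quasi_clique_minor pair_graph t.
Proof.
exists fibre; split; last exact: connected_fibres.
split=> [i|i j ij]; first by apply/set0Pn; exists (i, true); rewrite inE.
apply/pred0P => u /=; rewrite !inE.
by apply: contraNF ij => /andP[/eqP<- /eqP<-].
Qed.

End PairGraph.

(** * Excluding large clique minors *)

Lemma independent_third (T : finType) (r : rel T) (A : {set T}) : symmetric r ->
  (forall x, x \in A -> #|[set y in A | r x y || (y == x)]| <= 3) ->
  exists I : {set T}, [/\ I \subset A, #|A| <= 3 * #|I| &
    {in I &, forall x y, x != y -> ~~ r x y}].
Proof.
move=> rsym deg.
pose indep (I : {set T}) := (I \subset A) &&
  [forall x in I, forall y in I, (x != y) ==> ~~ r x y].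
have [I /maxsetP[/andP[IA /forall_inP Iind] Imax] _] :
    {I | maxset indep I & set0 \subset I}.
  apply: maxset_exists; rewrite /indep sub0set.
  by apply/forall_inP => x; rewrite inE.
exists I; split=> // [|x y xI yI xy]; last first.
  by have /forall_inP/(_ y yI)/implyP/(_ xy) := Iind x xI.
(* By maximality of [I], the closed neighbourhoods of its members, of size at most 3 each, cover
   [A]. *)
have cover : A \subset \bigcup_(x in I) [set y in A | r x y || (y == x)].
  apply/subsetP => y yA; apply/bigcupP.
  case: (boolP (y \in I)) => [yI|yI]; first by exists y; rewrite ?inE ?yA ?eqxx ?orbT.
  have /existsP[x /andP[xI rxy]] : [exists x in I, r x y].
    apply: contraNT yI => /exists_inPn nr.
    suff /Imax <- : indep (y |: I) by rewrite ?setU11 ?subsetU1.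
    rewrite /indep subUset sub1set yA IA /=.
    apply/forall_inP => a aI; apply/forall_inP => b bI; apply/implyP => ab.
    move: aI bI ab; rewrite !in_setU1 => /predU1P[->|aI] /predU1P[->|bI].
    - by rewrite eqxx.
    - by rewrite rsym nr.
    - by rewrite nr.
    - by move=> ab; have /forall_inP/(_ b bI)/implyP/(_ ab) := Iind a aI.
  by exists x; rewrite // inE yA rxy.
apply: leq_trans (subset_leq_card cover) _.
have : \sum_(x in I) #|[set y in A | r x y || (y == x)]| <= \sum_(x in I) 3.
  by apply: leq_sum => x xI; apply/deg/(subsetP IA).
by rewrite sum_nat_const mulnC; apply/leq_trans/leq_card_bigcup.
Qed.

Lemma connected_card2 (G : sgraph) (B : {set G}) (u v : G) :
  connected_graph (induced B) -> #|B| <= 2 -> u \in B -> v \in B -> u != v ->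
  adj u v.
Proof.
move=> conB cB uB vB uv.
have := conB (exist _ u uB) (exist _ v vB).
move=> /connectP[[|[x xB] p] /=]; first by move=> _ [] e; rewrite e eqxx in uv.
move=> /andP[ux _] _; move: ux; rewrite /induced_adj /= => ux.
have /eqP : B == [set u; v].
  by rewrite eq_sym eqEcard subUset !sub1set uB vB cards2 uv.
move=> defB; move: xB; rewrite defB !inE => /predU1P[|/eqP <- //].
by move=> e; rewrite e adj_irr in ux.
Qed.

(** A bag falls short of three vertices by at most 2, and only if it is small. *)
Lemma count_small_bags (G : sgraph) (p : nat) (B : 'I_p -> {set G}) : bags B ->
  3 * p <= #|G| + 2 * #|[set k | #|B k| <= 2]|.
Proof.
case=> B0 dis.
have tot : \sum_k #|B k| <= #|G|.
  under eq_bigr do rewrite -sum1_card.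
  by rewrite -partition_disjoint_bigcup // sum1_card max_card.
have : \sum_(k < p) 3 <= \sum_k (#|B k| + 2 * (#|B k| <= 2)).
  apply: leq_sum => k _.
  have : 0 < #|B k| by rewrite card_gt0.
  by case: (#|B k|) => [|[|[|m]]].
rewrite sum_nat_const card_ord big_split /= -big_distrr /= mulnC.
have -> : \sum_(k < p) (#|B k| <= 2 : nat) = #|[set k | #|B k| <= 2]|.
  rewrite -sum1dep_card [RHS]big_mkcond; apply: eq_bigr => k _.
  by case: (#|B k| <= 2).
by move=> le; apply: leq_trans le _; rewrite leq_add2r.
Qed.

Lemma pair_graph_no_clique_minor (t s p : nat)
    (w : {ffun 'I_t * 'I_t -> bool * bool}) :
  good_labelling s w ->
  2 * t + 6 * s <= 3 * p -> ~ has_clique_minor (pair_graph w) p.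
Proof.
move=> good les [B [bagB conB adjB]].
have [B0 disB] := bagB.
have uniqB u k l : u \in B k -> u \in B l -> k = l.
  move=> uk ul; apply/eqP; apply: contraTT uk => /disB dis.
  by rewrite (disjointFl dis ul).
pose S := [set k | #|B k| <= 2].
have leS : 3 * s <= #|S|.
  have := count_small_bags bagB; rewrite card_prod card_ord card_bool -/S; lia.
(* Two bags conflict if they meet a common fibre. Each of the at most two vertices of a small bag
   has one partner in its fibre, which lies in at most one bag; hence at most two conflicts with
   other bags. *)
pose r : rel 'I_p := fun k l =>
  [exists u in B k, exists v in B l, u.1 == v.1].
have rsym : symmetric r.
  suff rs k l : r k l -> r l k by move=> k l; apply/idP/idP; apply: rs.
  case/exists_inP=> u uk /exists_inP[v vl uv]; apply/exists_inP; exists v => //.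
  by apply/exists_inP; exists u; rewrite // eq_sym.
have degS k : k \in S -> #|[set l in S | r k l || (l == k)]| <= 3.
  rewrite inE => kS.
  pose N (u : pair_graph w) := [set l | (u.1, ~~ u.2) \in B l].
  have sub : [set l in S | r k l || (l == k)] \subset k |: \bigcup_(u in B k) N u.
    apply/subsetP => l; rewrite !inE => /andP[_ /orP[|->//]].
    case/exists_inP=> u uk /exists_inP[v vl /eqP uv].
    case: (eqVneq u.2 v.2) => [e|ne].
      have e' : u = v by case: u v uv e {uk vl} => [? ?] [? ?] /= -> ->.
      by rewrite e' in uk; rewrite (uniqB _ _ _ uk vl) eqxx.
    apply/orP; right; apply/bigcupP; exists u => //; rewrite inE.
    suff -> : (u.1, ~~ u.2) = v by [].
    by case: u v uv ne {uk vl} => [? []] [? []] /= ->.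
  apply: leq_trans (subset_leq_card sub) _.
  apply: leq_trans (leq_card_setU _ _) _; rewrite cards1 add1n ltnS.
  have : \sum_(u in B k) #|N u| <= \sum_(u in B k) 1.
    apply: leq_sum => u _; apply/card_le1_eqP => l l'; rewrite !inE.
    by move=> ul ul'; apply: uniqB ul' ul.
  rewrite sum1_card => leN; apply: leq_trans kS; apply: leq_trans leN.
  exact: leq_card_bigcup.
have [I [IS leI indI]] := independent_third rsym degS.
have les' : s <= #|I| by lia.
pose f (k : 'I_s) : 'I_p := enum_val (widen_ord les' k).
have fI k : f k \in I by exact: enum_valP.
have finj : injective f.
  by move=> k l /enum_val_inj /(congr1 val) /= /val_inj.
have fS k : #|B (f k)| <= 2 by have := subsetP IS _ (fI k); rewrite inE.
pose lam := [ffun i : 'I_t => [exists k, (i, true) \in B (f k)]].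
(* The chosen bags contain at most one vertex above each index: two in one small bag would have to
   be adjacent, and two in different bags would be a conflict. *)
have lamP k i x : (i, x) \in B (f k) -> lam i = x.
  case: x => uk; rewrite ffunE; first by apply/existsP; exists k.
  apply/existsP => -[l vl].
  case: (eqVneq k l) => [e|kl].
    rewrite -e in vl.
    have ne : ((i, false) : pair_graph w) != (i, true).
      by rewrite xpair_eqE andbF.
    have := connected_card2 (conB _) (fS k) uk vl ne.
    by rewrite /= /pair_adj eqxx.
  have fkl : f k != f l by rewrite (inj_eq finj).
  have /negP := indI _ _ (fI k) (fI l) fkl; apply.
  by apply/exists_inP; exists (i, false) => //; apply/exists_inP; exists (i, true).
pose pi := [ffun i : 'I_t => [pick k | (i, lam i) \in B (f k)]].
have piP k i : (pi i == Some k) = ((i, lam i) \in B (f k)).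
  rewrite ffunE; case: pickP => [l il|none]; last by rewrite none.
  apply/eqP/idP => [[<-]//|ik].
  by congr Some; apply: finj; apply: uniqB il ik.
have pi2 k : #|[set i | pi i == Some k]| <= 2.
  apply: leq_trans (fS k).
  have inj : injective (fun i : 'I_t => (i, lam i)) by move=> i j [].
  rewrite -(card_imset _ inj); apply/subset_leq_card/subsetP => _ /imsetP[i + ->].
  by rewrite inE piP.
have [k [l [kl wkl]]] := good lam pi pi2.
have fkl : f k != f l by rewrite (inj_eq finj).
have [[i x] [[j y] [uk vl]]] := adjB _ _ fkl.
have ex := lamP _ _ _ uk; have ey := lamP _ _ _ vl.
rewrite -ex -piP in uk; rewrite -ey -piP in vl.
have [wij wji] := wkl _ _ (eqP uk) (eqP vl).
(* Whichever of [i] and [j] is smaller, the label read by [missing] removes exactly the edge that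
   the minor provides. *)
by rewrite /= /pair_adj /missing /= wij wji ex ey !eqxx if_same andbF.
Qed.

Import Order.TTheory GRing.Theory Num.Theory.
Local Open Scope ring_scope.

Theorem theorem2 (R : realType) (eps : R) (eps_gt0 : 0 < eps) :
  exists t0 : nat, forall t : nat, (t0 <= t)%N ->
    exists G : sgraph,
      has_quasi_clique_minor G t /\
      forall p : nat, (2 / 3 + eps) * t%:R <= p%:R -> ~ has_clique_minor G p.
Proof.
have [M M_gt0 MS] : exists2 M, (0 < M)%N & (M.+1 = 4 ^ 8)%N.
  exists (4 ^ 8).-1; last by rewrite prednK ?expn_gt0.
  by rewrite -ltnS prednK ?expn_gt0 // -[1%N](expn0 4) ltn_exp2l.
(* With [d > 2 / eps], the number [s = t %/ d] of bags satisfies [6 * s <= 3 * eps * t], the surplus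
   of [3 * p] over [2 * t]. *)
pose d := (Num.truncn (2 / eps)).+1.
exists (4096 * M ^ 2 * d ^ 4)%N => t /(count_lt_expn M_gt0 (ltn0Sn _)) count.
have [w wP] : exists w, @good_labelling t (t %/ d) w.
  by apply: exists_good_labelling; rewrite -MS.
exists (pair_graph w); split; first exact: pair_graph_quasi_clique_minor.
move=> p lep; apply: pair_graph_no_clique_minor wP _.
have d_gt : 2 / eps < d%:R by exact: truncnS_gt.
have sd : ((t %/ d)%:R * d%:R <= t%:R :> R) by rewrite -natrM ler_nat leq_trunc_div.
have s_le : 2 * (t %/ d)%:R <= eps * t%:R.
  rewrite -ler_pdivrMl // mulrA [eps^-1 * 2]mulrC; apply: le_trans sd.
  by rewrite [X in _ <= X]mulrC ler_wpM2r // ltW.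
rewrite -(ler_nat R) natrD !natrM.
have : 3%:R * ((2 / 3 + eps) * t%:R) <= 3%:R * p%:R by rewrite ler_pM2l.
apply: le_trans.
rewrite [X in _ <= X]mulrA mulrDr mulrDl lerD //.
  by rewrite mulrCA divff ?mulr1 // pnatr_eq0.
by rewrite -mulrA (natrM _ 3 2) -mulrA ler_pM2l.
Qed.
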